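(* For every integer $d \geq 2$, there exists a probability measure $\mu$ on $\mathbb{Z}^d$ such that the set $E_\mu^1 = \{ s \in \mathbb{R}^d : \int_{\mathbb{Z}^d} e^{x\cdot s}\, d\mu(x) = 1 \}$ is not a closed subset of $\mathbb{R}^d$. In particular, for such a measure $\mu$, there exist a sequence $(f_n)$ of functions $\mathbb{Z}^d \to \mathbb{R}_+$ that are harmonic relative to $\mu$ and a function $f : \mathbb{Z}^d \to \mathbb{R}_+$ that is not harmonic relative to $\mu$ such that $f_n(x) \to f(x)$ for every $x \in \mathbb{Z}^d$.
   Context: Here $\mathbb{R}_+ = [0,+\infty)$, and $x \cdot s$ is the usual dot product on $\mathbb{R}^d$. Given a probability measure $\mu$ on $\mathbb{Z}^d$, a function $f : \mathbb{Z}^d \to \mathbb{R}_+$ is called harmonic relative to $\mu$ if $f(x_0) = \int_{\mathbb{Z}^d} f(x_0 + x)\, d\mu(x)$ for every $x_0 \in \mathbb{Z}^d$. The integrals of non-negative functions take values in $[0,+\infty]$. *)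

(* Defs.v *)
From HB Require Import structures.
From mathcomp Require Export all_boot all_order all_algebra.
From mathcomp Require Export all_classical all_reals all_analysis.
Export Order.TTheory GRing.Theory Num.Theory.
Export numFieldNormedType.Exports.

Set Implicit Arguments.
Unset Strict Implicit.
Unset Printing Implicit Defensive.

Local Open Scope classical_set_scope.
Local Open Scope ring_scope.

(* Alias of 'rV[int]_d carrying the discrete sigma-algebra. *)
Definition Zlattice (d : nat) : Type := 'rV[int]_d.

HB.instance Definition _ (d : nat) := GRing.Zmodule.on (Zlattice d).
HB.instance Definition _ (d : nat) := isPointed.Build (Zlattice d) 0.
HB.instance Definition _ (d : nat) :=
  @isMeasurable.Build default_measure_display (Zlattice d)
    discrete_measurable discrete_measurable0
    discrete_measurableC discrete_measurableU.

Section harmonic.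
Context {R : realType} {d : nat}.
Implicit Types (x : Zlattice d) (s : 'rV[R]_d) (mu : probability (Zlattice d) R).

Definition dot x s : R := \sum_(i < d) ((x : 'rV[int]_d) 0 i)%:~R * s 0 i.

Definition E1 mu : set 'rV[R]_d :=
  [set s | (\int[mu]_x (expR (dot x s))%:E = 1)%E].

(* Only meaningful for nonnegative f, so that the integral is that of a
   nonnegative function. *)
Definition harmonic mu (f : Zlattice d -> R) : Prop :=
  forall x0, ((f x0)%:E = \int[mu]_x (f (x0 + x))%:E)%E.

End harmonic.

(* Main.v *)
From HB Require Import structures.
Require Import Defs.
From mathcomp Require Import measurable_realfun ring lra.

(** Write L(s) for the integral of e^(x.s) against mu, so that E1 mu is the
    level set L = 1 of a convex, lower semicontinuous function. Such an L can
    fail to be continuous on its domain: if s is a limit of points of the level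
    set, lower semicontinuity only gives L(s) <= 1, and the first half of the
    theorem asks for a measure where this is strict.

    Take mu carried by the points (n, 2 - n^2) of a parabola, n ranging over
    rapidly growing integers n_k, with mass proportional to r_k e^(-n_k^2),
    where r_k = 2^-(k+1). Then
      L(a, b - 1) = Z^-1 e^(2(b - 1)) sum_k r_k e^(a n_k - b n_k^2),
    where Z lies between 1/2 and 1. At the point (0, -1), that is a = b = 0,
    the sum is at most 1 and L is at most 2 e^-2 < 1. Fix a small a > 0. If
    b = a the exponents a n - b n^2 are nonpositive and still L < 1. If b is
    positive and tiny, L is finite because a n - b n^2 is bounded above, but
    the terms with b n_k^2 of order 1 are comparable to r_k e^(a n_k), which is
    unbounded in k since the r_k decay slowly compared with n_k; so L >= 1 for
    a suitable b < a (parabola_probability gives both estimates). Hence L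
    crosses the value 1 somewhere on the vertical segment between these two
    values of b (laplace_segment_eq1), at distance at most a from (0, -1). As
    a tends to 0, the point (0, -1), which is not in E1 mu, is a limit of
    points of E1 mu. In higher dimension the remaining coordinates are zero.

    For the second half, x |-> e^(x.s) is harmonic exactly when s is in E1 mu,
    and it depends continuously on s; a sequence in E1 mu that converges to a
    point outside E1 mu gives the functions required. *)

Local Open Scope classical_set_scope.
Local Open Scope ring_scope.

(** Stated through integrals of nonnegative functions, which is the only way
    the measure is used below. *)
Lemma discrete_probability {R : realType} {disp : measure_display}
    {T : measurableType disp} (x : nat -> T) (p : nat -> R) :
  (forall k, 0 <= p k) -> (\sum_(k <oo) (p k)%:E = 1)%E ->
  exists P : probability T R, forall f : T -> R,
    measurable_fun setT f -> (forall t, 0 <= f t) ->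
    (\int[P]_t (f t)%:E = \sum_(k <oo) (p k * f (x k))%:E)%E.
Proof.
move=> p0 p1.
pose m_ k : {measure set T -> \bar R} := mscale (NngNum (p0 k)) (\d_(x k)).
pose P : {measure set T -> \bar R} := mseries m_ 0.
have PT : P setT = 1%E.
  rewrite -p1; apply: eq_eseriesr => k _.
  by rewrite /m_ /= /mscale /= diracT mule1.
pose P' := Measure_isProbability.Build _ _ _ P PT.
pose Q : probability T R := HB.pack (mseries m_ 0) P'.
exists Q => f mf f0.
have /measurable_EFinP mEf := mf.
rewrite (_ : integral _ _ _ = (\int[mseries m_ 0]_t (f t)%:E)%E)//.
rewrite ge0_integral_measure_series//; last by move=> t _; rewrite lee_fin.
apply: eq_eseriesr => k _.
rewrite ge0_integral_mscale//; last by move=> t _; rewrite lee_fin.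
by rewrite integral_dirac// diracT mul1e.
Qed.

(** * Exponential moments and harmonic exponentials *)

Section exponential_moments.
Context {R : realType} {d : nat}.
Implicit Types (x : Zlattice d) (s : 'rV[R]_d) (mu : probability (Zlattice d) R).

Definition laplace mu s : \bar R := (\int[mu]_x (expR (dot x s))%:E)%E.

Lemma measurable_fun_Zlattice (disp : measure_display)
  (U : measurableType disp) (f : Zlattice d -> U) : measurable_fun setT f.
Proof. by []. Qed.

Lemma dotDl x y s : dot (x + y) s = dot x s + dot y s.
Proof.
rewrite /dot -big_split; apply: eq_bigr => i _ /=.
by rewrite -mulrDl -rmorphD/= mxE.
Qed.

Lemma dot0l s : dot (0 : Zlattice d) s = 0.
Proof. by rewrite /dot big1// => i _; rewrite mxE mul0r. Qed.

Lemma dot_segment x s0 s1 (t : R) :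
  dot x (s0 + t *: (s1 - s0)) = dot x s0 + t * (dot x s1 - dot x s0).
Proof.
rewrite /dot -sumrB mulr_sumr -big_split; apply: eq_bigr => i _ /=.
by rewrite !mxE; ring.
Qed.

Lemma continuous_dot x : continuous (fun s => dot x s).
Proof.
have := @continuous_big R 'I_d +%R 0 xpredT (@add_continuous R)
  'rV[R]_d (index_enum 'I_d) (fun i s => ((x : 'rV[int]_d) 0 i)%:~R * s 0 i).
apply=> i _ s.
exact: (cvgM (cvg_cst _) (@coord_continuous R 1 d 0 i s)).
Qed.

Lemma integrable_expR_dot mu s : (laplace mu s < +oo)%E ->
  mu.-integrable setT (fun x => (expR (dot x s))%:E).
Proof.
move=> fin; apply/integrableP; split.
  exact: measurable_fun_Zlattice.
by under eq_integral do rewrite gee0_abs ?lee_fin ?expR_ge0//.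
Qed.

(** By convexity of the exponential, e^(x.s) <= e^(x.s0) + e^(x.s1) for all s in
    the segment [s0, s1]. This integrable bound makes L continuous along the
    segment, endpoints included, although L may be discontinuous as a function
    on its domain; the intermediate value theorem then applies. *)
Lemma laplace_segment_eq1 mu s0 s1 :
  (laplace mu s0 <= 1)%E -> (1 <= laplace mu s1)%E -> (laplace mu s1 < +oo)%E ->
  exists2 t : R, 0 <= t <= 1 & laplace mu (s0 + t *: (s1 - s0)) = 1%E.
Proof.
move=> le0 ge1 fin1.
have fin0 : (laplace mu s0 < +oo)%E by rewrite (le_lt_trans le0) ?ltry.
(* Continuity under the integral sign is available on open intervals only;
   clamping the parameter to [0, 1] makes the domination hold on a larger one,
   so that both endpoints of the segment are covered. *)
pose c : R -> R := (fun=> 0) \max ((fun=> 1) \min id).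
have c01 t : 0 <= c t <= 1.
  by rewrite /c /= le_max ge_max lexx ler01/= ge_min lexx.
have cid t : 0 <= t <= 1 -> c t = t.
  by case/andP=> t0 t1; rewrite /c /= min_r// max_r.
have cc : continuous c.
  move=> t; apply: continuous_max; first exact: cvg_cst.
  by apply: continuous_min; [exact: cvg_cst|exact: cvg_id].
pose f t x : R := expR (dot x (s0 + c t *: (s1 - s0))).
pose g x : R := expR (dot x s0) + expR (dot x s1).
have fg t x : f t x <= g x.
  rewrite /f dot_segment; have /andP[t0 t1] := c01 t.
  have e0 := expR_ge0 (dot x s0); have e1 := expR_ge0 (dot x s1).
  have [le01|lt10] := leP (dot x s0) (dot x s1).
    apply: (@le_trans _ _ (expR (dot x s1))); last by rewrite lerDr.
    by rewrite ler_expR; nra.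
  apply: (@le_trans _ _ (expR (dot x s0))); last by rewrite lerDl.
  by rewrite ler_expR; nra.
have ig : mu.-integrable setT (EFin \o g).
  have -> : EFin \o g = (fun x => (expR (dot x s0))%:E + (expR (dot x s1))%:E)%E.
    by [].
  by apply: integrableD => //; exact: integrable_expR_dot.
have iF t : mu.-integrable setT (EFin \o f t).
  apply: (le_integrable measurableT _ _ ig).
    exact: measurable_fun_Zlattice.
  move=> x _; rewrite !abse_EFin lee_fin !ger0_norm ?expR_ge0//.
  by rewrite addr_ge0 ?expR_ge0.
have fc x : continuous (f ^~ x).
  have -> : f ^~ x =
      expR \o (fun t => dot x s0 + c t * (dot x s1 - dot x s0)).
    by apply/funext => t; rewrite /f dot_segment.
  move=> t; apply: continuous_comp; last exact: continuous_expR.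
  apply: cvgD; first exact: cvg_cst.
  by apply: cvgM; [exact: cc|exact: cvg_cst].
pose L t : R := (\int[mu]_x f t x)%R.
have LE t : (L t)%:E = laplace mu (s0 + c t *: (s1 - s0)).
  by rewrite /L /Rintegral fineK// (integrable_fin_num measurableT (iF t)).
have Lc : {in `](-1 : R), 2[%classic, continuous L}.
  apply: (@continuity_under_integral R _ _ mu f setT measurableT (-1) 2
    (fun t _ => iF t) _ g ig).
  - by apply: aeW => x _ t _; exact: fc.
  - by move=> t _; apply: aeW => x _; rewrite ger0_norm ?expR_ge0.
have Lc01 : {within `[0, 1], continuous L}.
  apply: continuous_in_subspaceT => t /set_mem; rewrite /= in_itv/= => /andP[t0 t1].
  by apply: Lc; apply/mem_set; rewrite /= in_itv/=; apply/andP; split; lra.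
have c00 : 0 <= (0 : R) <= 1 by rewrite lexx ler01.
have c11 : 0 <= (1 : R) <= 1 by rewrite lexx ler01.
have L0 : L 0 <= 1.
  by rewrite -lee_fin LE (cid _ c00) scale0r addr0.
have L1 : 1 <= L 1.
  by rewrite -lee_fin LE (cid _ c11) scale1r addrC subrK.
have L01 : Num.min (L 0) (L 1) <= 1 <= Num.max (L 0) (L 1).
  clearbody L; clear -L0 L1.
  by rewrite ge_min le_max L0 L1 orbT.
have [t] := IVT ler01 Lc01 L01.
rewrite in_itv/= => t01 Lt; exists t; first exact: t01.
by rewrite -{1}(cid _ t01) -LE Lt.
Qed.

Lemma harmonic_expR_dot mu s : laplace mu s = 1%E ->
  harmonic mu (fun x => expR (dot x s)).
Proof.
move=> L1 x0.
under eq_integral do rewrite dotDl expRD EFinM.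
rewrite ge0_integralZl_EFin ?expR_ge0//.
by rewrite -/(laplace mu s) L1 mule1.
Qed.

Lemma harmonic_limit_failure mu : ~ closed (E1 mu) ->
  exists (f_ : nat -> Zlattice d -> R) (f : Zlattice d -> R),
    [/\ (forall n x, 0 <= f_ n x) /\ (forall n, harmonic mu (f_ n)),
        (forall x, 0 <= f x) /\ ~ harmonic mu f &
        forall x, f_ n x @[n --> \oo] --> f x].
Proof.
rewrite /closed => /existsNP[s /not_implyP[cls nEs]].
have /choice[s_ Hs] : forall n, exists s', E1 mu s' /\ ball s (n.+1%:R^-1 : R) s'.
  move=> n; have [|s' Hs'] := cls (ball s (n.+1%:R^-1 : R)).
    by apply: nbhsx_ballx; rewrite invr_gt0.
  by exists s'; exact: Hs'.
have s_s : s_ n @[n --> \oo] --> s.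
  apply/cvg_ballP => e e0; near=> n.
  apply: (@le_ball _ _ _ n.+1%:R^-1) (proj2 (Hs n)).
  by apply/ltW; near: n; exact: (near_infty_natSinv_lt (PosNum e0)).
exists (fun n x => expR (dot x (s_ n))), (fun x => expR (dot x s)); split.
- split=> [n x|n]; first exact: expR_ge0.
  exact: harmonic_expR_dot (proj1 (Hs n)).
- (* At the origin, harmonicity of the limit would read L(s) = 1. *)
  split=> [x|/(_ 0)]; first exact: expR_ge0.
  rewrite dot0l expR0; under eq_integral do rewrite add0r.
  by move=> /esym.
- move=> x; have dot_cvg := cvg_comp _ _ s_s (@continuous_dot x s).
  exact: (cvg_comp _ _ dot_cvg (@continuous_expR R (dot x s))).
Unshelve. all: by end_near.
Qed.

End exponential_moments.


(** * A measure on a parabola *)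

Section parabola.
Context {R : realType}.
Variable d : nat.

Definition planar {V : nmodType} (a b : V) : 'rV[V]_d.+2 :=
  \row_(i < d.+2) nth 0 [:: a; b] i.

Lemma dot_planar (m n : int) (a b : R) :
  dot (planar m n : Zlattice d.+2) (planar a b) = m%:~R * a + n%:~R * b.
Proof.
rewrite /dot !big_ord_recl big1 => [|i _]; last by rewrite !mxE /= nth_nil mul0r.
by rewrite !mxE /= addr0.
Qed.

(** The factor 2 ^ k.+1 compensates the weight 2 ^- k.+1 of the k-th point: for
    a > 0, weight times e^(a n_k) is at least a k, hence unbounded in k. The
    value at 0 being 0, the heaviest point contributes 1/2 to the total mass. *)
Definition abscissa (k : nat) : nat := (k * 2 ^ k.+1)%N.

(** The weight e^(-n^2) is chosen to be cancelled by e^(x.s) at s = (0, -1), up to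
    the factor e^-2 due to the height 2 of the parabola. That factor outweighs
    the normalising constant, which is at most 2, and makes L(0, -1) < 1. *)
Lemma parabola_probability : exists mu : probability (Zlattice d.+2) R,
  (forall a b c, (forall k, a * (abscissa k)%:R - b * (abscissa k)%:R ^+ 2 <= c) ->
     (laplace mu (planar a (b - 1)) <= (2 * expR (c + 2 * (b - 1)))%:E)%E) /\
  (forall a b k,
     (((2 ^ k.+1)%:R^-1 * expR (a * (abscissa k)%:R - b * (abscissa k)%:R ^+ 2
        + 2 * (b - 1)))%:E <= laplace mu (planar a (b - 1)))%E).
Proof.
pose n k : R := (abscissa k)%:R.
pose r k : R := (2 ^ k.+1)%:R^-1.
have r0 k : 0 <= r k by rewrite /r invr_ge0.
have r_sum : (\sum_(k <oo) (r k)%:E <= 1)%E.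
  have := epsilon_trick0 xpredT (@ler01 R).
  by under eq_eseriesr do rewrite div1r.
pose w k := r k * expR (- n k ^+ 2).
have w0 k : 0 <= w k by rewrite mulr_ge0// expR_ge0.
have wr k : w k <= r k.
  by rewrite ler_piMr// -expR0 ler_expR oppr_le0 sqr_ge0.
have Z1 : (\sum_(k <oo) (w k)%:E <= 1)%E.
  apply: le_trans r_sum; apply: lee_nneseries => [k _ _|k _]; rewrite lee_fin//.
have Z2 : ((2^-1)%:E <= \sum_(k <oo) (w k)%:E)%E.
  apply: le_trans (nneseries_lim_ge 1 _); last by move=> k _ _; rewrite lee_fin.
  by rewrite big_nat1 /w /r /n /abscissa mul0n expr0n oppr0 expR0 mulr1.
pose Z := fine (\sum_(k <oo) (w k)%:E)%E.
have ZE : (\sum_(k <oo) (w k)%:E)%E = Z%:E.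
  rewrite fineK// ge0_fin_numE; first by rewrite (le_lt_trans Z1) ?ltry.
  by apply: le_trans Z2; rewrite lee_fin.
rewrite ZE !lee_fin in Z1 Z2.
have Z0 : 0 < Z by lra.
have iZ0 : 0 <= Z^-1 by rewrite invr_ge0 ltW.
have iZ1 : 1 <= Z^-1 by rewrite -invr1 lef_pV2// posrE.
have iZ2 : Z^-1 <= 2 by rewrite -(invrK 2) lef_pV2// posrE.
pose p k := Z^-1 * w k.
have p0 k : 0 <= p k by rewrite mulr_ge0.
have p1 : (\sum_(k <oo) (p k)%:E = 1)%E.
  under eq_eseriesr do rewrite EFinM.
  rewrite nneseriesZl; last by move=> k _; rewrite lee_fin.
  by rewrite ZE -EFinM mulVf// gt_eqF.
pose x k : Zlattice d.+2 :=
  planar (abscissa k : int) (2%:Z - (abscissa k ^ 2)%N%:Z).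
have [mu muE] := discrete_probability x p p0 p1.
have wE a b k : w k * expR (dot (x k) (planar a (b - 1))) =
    r k * expR (a * n k - b * n k ^+ 2 + 2 * (b - 1)).
  rewrite /w /x dot_planar -mulrA -expRD; congr (_ * expR _).
  by rewrite rmorphB /= -!pmulrn natrX /n; ring.
have LE a b : laplace mu (planar a (b - 1)) =
    (\sum_(k <oo) (Z^-1 * (r k * expR (a * n k - b * n k ^+ 2 + 2 * (b - 1))))%:E)%E.
  rewrite /laplace muE//.
  by apply: eq_eseriesr => k _; rewrite /p -mulrA wE.
exists mu; split=> [a b c abc|a b k]; rewrite LE.
- rewrite -[leRHS]mule1.
  apply: le_trans (lee_wpmul2l _ r_sum); last by rewrite lee_fin mulr_ge0// expR_ge0.
  rewrite -nneseriesZl; last by move=> k _; rewrite lee_fin.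
  apply: lee_nneseries => [k _ _|k _].
    by rewrite lee_fin !mulr_ge0// ?expR_ge0.
  rewrite -EFinM lee_fin mulrCA mulrC ler_wpM2r//.
  by apply: ler_pM => //; rewrite ?expR_ge0// ler_expR lerD2r; exact: abc.
- apply: le_trans (nneseries_lim_ge k.+1 _); last first.
    by move=> i _ _; rewrite lee_fin !mulr_ge0// ?expR_ge0.
  rewrite big_nat_recr//= -/(n k) -/(r k).
  apply: le_trans (leeDr _ _); last first.
    by apply: sume_ge0 => i _; rewrite lee_fin !mulr_ge0// ?expR_ge0.
  by rewrite lee_fin ler_peMl// mulr_ge0// expR_ge0.
Qed.

(** For each small a the level 1 is crossed on the segment between (a, a - 1) and
    (a, n_k^-2 - 1), where k depends on a; these crossings tend to (0, -1). *)
Lemma E1_not_closed : exists mu : probability (Zlattice d.+2) R, ~ closed (E1 mu).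
Proof.
have [mu [ub lb]] := parabola_probability; exists mu => clE.
have e2 : (2 : R) < expR 1 by rewrite -[ltLHS]/(1 + 1) expR_gt1Dx ?oner_eq0.
have diag a : 0 <= a <= 2^-1 -> (laplace mu (planar a (a - 1)) < 1)%E.
  case/andP=> a0 a1; apply: le_lt_trans (ub a a 0 _) _ => [k|].
    rewrite subr_le0 ler_wpM2l// -natrX ler_nat.
    by case: (abscissa k) => // m; rewrite leq_pmulr.
  have le1 : expR (0 + 2 * (a - 1)) <= expR (- 1) by rewrite ler_expR; lra.
  rewrite lte_fin (le_lt_trans (ler_wpM2l _ le1))// expRN.
  by rewrite ltr_pdivrMr ?expR_gt0// mul1r.
have : E1 mu (planar 0 (0 - 1)).
  apply: clE => B /nbhs_ballP[e /= e0 eB].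
  pose a := Num.min (e / 2) 2^-1.
  have a0 : 0 < a by rewrite /a lt_min divr_gt0//=.
  have ae : a < e by rewrite /a gt_min; apply/orP; left; lra.
  have a2 : a <= 2^-1 by rewrite /a ge_min lexx orbT.
  (* With b = n_k^-2, the k-th term is at least e^-3 r_k e^(a n_k), hence at
     least e^-3 a k, so that a k >= e^3 makes this term alone at least 1. The
     additional 1 gives a k >= 1, hence b <= a. *)
  pose k := (Num.trunc ((expR 3 + 1) / a)).+1.
  have ka : (expR 3 + 1) / a <= k%:R by rewrite ltW// truncnS_gt.
  pose n : R := (abscissa k)%:R.
  have nk : n = k%:R * (2 ^ k.+1)%:R by rewrite -natrM.
  have k1 : 1 <= k%:R :> R by rewrite ler1n.
  have t1 : 1 <= (2 ^ k.+1)%:R :> R by rewrite ler1n expn_gt0.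
  have n1 : k%:R <= n by rewrite nk ler_peMr.
  have n0 : 0 < n by lra.
  pose b := n ^- 2.
  have b0 : 0 < b by rewrite invr_gt0 exprn_gt0.
  have bn : b * n ^+ 2 = 1 by rewrite mulVf// expf_neq0// gt_eqF.
  have e3 := expR_gt0 (3 : R).
  have ka' : expR 3 + 1 <= a * k%:R by rewrite mulrC -ler_pdivrMr.
  have ba : b <= a.
    have : 1 <= a * n ^+ 2.
      rewrite expr2; nra.
    by rewrite -bn ler_pM2r// exprn_gt0.
  have [|||t /andP[t0 t1'] Lt] :=
      @laplace_segment_eq1 R _ mu (planar a (a - 1)) (planar a (b - 1)).
  - by rewrite ltW// diag// a2 ltW.
  - apply: le_trans (lb a b k); rewrite lee_fin -/n bn.
    have an : a * n <= expR (a * n) by apply: le_trans (expR_ge1Dx _); lra.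
    have -> : a * n - 1 + 2 * (b - 1) = a * n + (2 * b - 3) by ring.
    rewrite ler_pdivlMl ?ltr0n ?expn_gt0// mulr1 expRD.
    apply: (@le_trans _ _ (a * n * expR (- 3))); last first.
      by apply: ler_pM => //; rewrite ?expR_ge0 ?mulr_ge0 ?ler_expR ?ltW//; lra.
    rewrite expRN ler_pdivlMr// nk; nra.
  - apply: le_lt_trans (ub a b (a ^+ 2 / (4 * b)) _) (ltry _) => k'.
    rewrite ler_pdivlMr ?mulr_gt0//.
    (* Maximum of the parabola a n - b n^2, attained at n = a / (2 b). *)
    have := sqr_ge0 (a - 2 * b * (abscissa k')%:R); nra.
  exists (planar a (a + t * (b - a) - 1)); split.
    rewrite -[E1 _ _]/(laplace _ _ = _) -Lt; congr (laplace mu _).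
    apply/rowP => -[i ip]; rewrite !mxE/=; case: i {ip} => [|[|i]]/=.
    - by ring.
    - by ring.
    - by rewrite nth_nil; ring.
  apply: eB; split=> // i [j jd]; rewrite !mxE/= /ball/=.
  case: j {jd} => [|[|j]]/=.
  - by rewrite sub0r normrN gtr0_norm.
  - by rewrite ltr_norml; apply/andP; split; nra.
  - by rewrite nth_nil subrr normr0.
have : (laplace mu (planar 0 (0 - 1)) < 1)%E.
  by apply: diag; rewrite lexx invr_ge0 ler0n.
by move=> + L1; rewrite [laplace _ _]L1 ltxx.
Qed.

End parabola.

Theorem theorem2 (R : realType) (d : nat) (d_ge2 : (2 <= d)%N) :
  (exists mu : probability (Zlattice d) R, ~ closed (E1 mu)) /\
  (forall mu : probability (Zlattice d) R, ~ closed (E1 mu) ->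
     exists (f_ : nat -> Zlattice d -> R) (f : Zlattice d -> R),
       [/\ (forall n x, 0 <= f_ n x) /\ (forall n, harmonic mu (f_ n)),
           (forall x, 0 <= f x) /\ ~ harmonic mu f &
           forall x, f_ n x @[n --> \oo] --> f x]).
Proof.
split; last by move=> mu; exact: harmonic_limit_failure.
by case: d d_ge2 => [|[|d]]// _; exact: E1_not_closed.
Qed.
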